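(* Let $X$ be a real Banach space with norm $\|\cdot\|$, and let $\Phi: X\to\mathbb{R}$ be a locally Lipschitz functional. For $z_0,z_1\in X$ define $$\Gamma:=\{c\in C^0([0,1];X): c(0)=z_0,\ c(1)=z_1\},\qquad \gamma:=\inf_{c\in\Gamma}\max_{0\le t\le 1}\Phi(c(t)),$$ and set $\Phi_\gamma:=\{x\in X:\Phi(x)\ge\gamma\}$. Let $F\subset X$ be a closed subset such that $F\cap\Phi_\gamma$ separates $z_0$ and $z_1$. If $\Phi$ satisfies the $(CPS)_{F,\gamma;\delta}$ condition, then $\gamma$ is a critical value of $\Phi$: there exists $\bar x\in X$ with $\Phi(\bar x)=\gamma$ and $0\in\partial\Phi(\bar x)$.
   Context: $C^0([0,1];X)$ is the space of continuous maps from $[0,1]$ to $X$. Clarke generalized gradient: for a locally Lipschitz $\Phi:X\to\mathbb{R}$, the generalized directional derivative is $\Phi^0(x,v):=\limsup_{w\to x,\ t\downarrow 0}\frac{\Phi(w+tv)-\Phi(w)}{t}$, and $\partial\Phi(x):=\{x^*\in X^*:\langle x^*,v\rangle\le\Phi^0(x,v)\ \forall v\in X\}$. Geodesic distance: $\delta(x_1,x_2):=\inf\{l(c): c\in C^1([0,1],X),\ c(0)=x_1,\ c(1)=x_2\}$ with $l(c):=\int_0^1\frac{\|\dot c(t)\|}{1+\|c(t)\|}\,dt$; and $\mathrm{dist}_\delta(x,F):=\inf\{\delta(x,y):y\in F\}$. $(CPS)_{F,c;\delta}$ condition (for a closed $F\subset X$ and $c\in\mathbb{R}$): every sequence $\{x_n\}\subset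 X$ with (1) $\mathrm{dist}_\delta(x_n,F)\to0$, (2) $\Phi(x_n)\to c$, (3) $(1+\|x_n\|)\min_{y^*\in\partial\Phi(x_n)}\|y^*\|\to0$ has a (norm-)convergent subsequence. Separation: a closed set $S\subset X$ separates $z_0$ and $z_1$ if $X\setminus S=\Omega_0\cup\Omega_1$ with $\Omega_0,\Omega_1$ open, $\Omega_0\cap\Omega_1=\emptyset$, $z_0\in\Omega_0$ and $z_1\in\Omega_1$. *)

(* Defs.v *)
From HB Require Import structures.
From mathcomp Require Import all_boot all_order all_algebra.
From mathcomp Require Import all_classical all_reals all_analysis.

Set Implicit Arguments.
Unset Strict Implicit.
Unset Printing Implicit Defensive.

Import Order.TTheory GRing.Theory Num.Theory.
Import numFieldNormedType.Exports.

Local Open Scope classical_set_scope.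
Local Open Scope ring_scope.

Definition locally_lipschitz (R : realType) (X : normedModType R)
    (Phi : X -> R) : Prop :=
  forall x : X, exists2 U : set X, nbhs x U & [lipschitz Phi y | y in U].

Definition clarke_dderiv (R : realType) (X : normedModType R)
    (Phi : X -> R) (x v : X) : \bar R :=
  limf_esup
    (fun wt : X * R => ((Phi (wt.1 + wt.2 *: v) - Phi wt.1) / wt.2)%:E)
    (filter_prod (nbhs x) 0^'+).

(* X^* is represented by the continuous functionals among {linear X -> R^o}. *)
Definition clarke_gradient (R : realType) (X : normedModType R)
    (Phi : X -> R) (x : X) : set {linear X -> R^o} :=
  [set f : {linear X -> R^o} | continuous f /\
           forall v : X, ((f v : R)%:E <= clarke_dderiv Phi x v)%E].

Definition dual_norm (R : realType) (X : normedModType R)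
    (f : {linear X -> R^o}) : R :=
  sup [set `|f v| | v in [set v : X | `|v| <= 1]].

Definition is_max (R : realType) (A : set R) (M : R) : Prop :=
  A M /\ ubound A M.

Definition is_min (R : realType) (A : set R) (m : R) : Prop :=
  A m /\ lbound A m.

(* A map on [0, 1] is represented by a function on R of which only the values
   on [0, 1] are used; in particular the derivative at 0 and 1 is one-sided. *)
Definition velocity (R : realType) (X : normedModType R)
    (c : R -> X) (t : R) : X :=
  lim ((s - t)^-1 *: (c s - c t) @[s --> within `[0, 1] t^']).

Definition C1_curve (R : realType) (X : normedModType R) (c : R -> X) : Prop :=
  (forall t : R, t \in `[0, 1] ->
    cvg ((s - t)^-1 *: (c s - c t) @[s --> within `[0, 1] t^'])) /\
  {within `[0, 1], continuous (velocity c)}.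

Definition curve_length (R : realType) (X : normedModType R)
    (c : R -> X) : \bar R :=
  (\int[lebesgue_measure]_(t in `[0%R, 1%R])
     (`|velocity c t| / (1 + `|c t|))%:E)%E.

Definition geodesic_dist (R : realType) (X : normedModType R)
    (x1 x2 : X) : \bar R :=
  ereal_inf [set curve_length c |
    c in [set c : R -> X | [/\ C1_curve c, c 0 = x1 & c 1 = x2]]].

Definition geodesic_setdist (R : realType) (X : normedModType R)
    (x : X) (F : set X) : \bar R :=
  ereal_inf [set geodesic_dist x y | y in F].

Definition CPS (R : realType) (X : normedModType R)
    (Phi : X -> R) (F : set X) (c : R) : Prop :=
  forall (x : nat -> X) (m : nat -> R),
    geodesic_setdist (x n) F @[n --> \oo] --> 0%E ->
    Phi (x n) @[n --> \oo] --> c ->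
    (forall n : nat,
      is_min [set dual_norm f | f in clarke_gradient Phi (x n)] (m n)) ->
    (1 + `|x n|) * m n @[n --> \oo] --> (0 : R) ->
    exists k : nat -> nat, increasing_seq k /\ cvg (x (k n) @[n --> \oo]).

(* The decomposition of ~` S into two open sets already forces S to be closed. *)
Definition separates (R : realType) (X : normedModType R)
    (S : set X) (z0 z1 : X) : Prop :=
  exists Omega0 Omega1 : set X,
    [/\ open Omega0, open Omega1, ~` S = Omega0 `|` Omega1,
        Omega0 `&` Omega1 = set0 & Omega0 z0 /\ Omega1 z1].

Definition paths (R : realType) (X : normedModType R)
    (z0 z1 : X) : set (R -> X) :=
  [set c : R -> X | [/\ {within `[0, 1], continuous c}, c 0 = z0 & c 1 = z1]].

Definition minimax_value (R : realType) (X : normedModType R)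
    (Phi : X -> R) (z0 z1 : X) : R :=
  inf [set M : R | exists2 c : R -> X, paths z0 z1 c &
                     is_max [set Phi (c t) | t in `[0, 1]] M].

Definition superlevel (R : realType) (X : normedModType R)
    (Phi : X -> R) (a : R) : set X := [set x | a <= Phi x].

(* Main.v *)
From HB Require Import structures.
Require Import Defs.
From mathcomp Require Import all_boot all_order all_algebra.
From mathcomp Require Import all_classical all_reals all_analysis.
From mathcomp Require Import measurable_realfun lra.

(* Suppose that no point is almost critical at level gamma near F: every [x]
   with [|x - y| <= e (1 + |x|)] for some [y] in [F] and [|Phi x - gamma| <= e]
   has a direction [v], [|v| <= 1], with [Phi^0(x, v) < - e / (1 + |x|)]. Start
   from a path [c0] with [Phi <= gamma + eta] and deform it during a time
   [tau <= T], each point moving at speed at most [w = 1 + |c0|]. Only the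
   parameters [A] at which [c0] is within [T w] of [F] matter, since no other
   point can reach [F]. On [A] the bound [Phi <= gamma + eta - k tau] is kept:
   only points where equality holds have to be moved, and these are steep. The
   steps are built from finitely many bumps on [[0, 1]]; a maximal element for
   the order "reachable in the elapsed time" has [tau = T], so the final path
   is below [gamma] wherever it meets [F]. It therefore misses the separating
   set, which is absurd.

   This produces almost critical points for every [e]. The geodesic distance to
   [F] is bounded along a segment, and the minimal norm of the gradient is the
   steepest descent rate (Hahn-Banach), so the compactness condition gives a
   limit point, which is critical by upper semicontinuity of [Phi^0]. *)

Import Order.TTheory GRing.Theory Num.Theory.
Import numFieldNormedType.Exports.
Local Open Scope classical_set_scope.
Local Open Scope ring_scope.

(** * Linear minorants of sublinear functionals *)

Section HahnBanach.
Variables (R : realType) (V : lmodType R).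
Implicit Types (p q : V -> R) (u v k : V) (a s : R).

(** One inequality suffices for homogeneity: used with [a^-1] at [a *: v] it gives the converse.
    Both clauses, being inequalities, pass to infima. *)
Definition sublinear q :=
  (forall u v, q (u + v) <= q u + q v) /\
  (forall a v, 0 < a -> q (a *: v) <= a * q v).

Lemma sublinear0 q : sublinear q -> q 0 = 0.
Proof.
move=> [_ qZ]; apply/eqP; rewrite eq_le; apply/andP; split.
- have h : 0 < 2^-1 :> R by rewrite invr_gt0 ltr0n.
  by have := qZ _ 0 h; rewrite scaler0; lra.
- have h : 0 < 2 :> R by rewrite ltr0n.
  by have := qZ _ 0 h; rewrite scaler0; lra.
Qed.

Lemma sublinearN_ge q v : sublinear q -> - q (- v) <= q v.
Proof.
move=> qs; have [qD _] := qs; have := qD v (- v).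
by rewrite subrr sublinear0//; lra.
Qed.

Lemma sublinear_odd q : sublinear q -> (forall u, q (- u) <= - q u) ->
  linear (q : V -> R^o).
Proof.
move=> qs qN; have [qD qZ] := qs.
have qNE u : q (- u) = - q u.
  by apply/eqP; rewrite eq_le qN /= lerNl sublinearN_ge.
have qZE a v : 0 < a -> q (a *: v) = a * q v.
  move=> a0; apply/eqP; rewrite eq_le qZ//=.
  by have := qZ a (- v) a0; rewrite scalerN !qNE; lra.
have qDE u v : q (u + v) = q u + q v.
  apply/eqP; rewrite eq_le qD /=.
  by have := qD (- u) (- v); rewrite -opprD !qNE; lra.
move=> a u v; rewrite qDE; congr (_ + _).
have [a0|a0|->] := ltgtP a 0.
- have := qZE (- a) u; rewrite oppr_gt0 => /(_ a0).
  by rewrite scaleNr qNE mulNr => /oppr_inj.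
- exact: qZE.
- by rewrite !scale0r sublinear0.
Qed.

(** [C] is a convex cone of lower bounds [s] prescribed at [k]. The new functional is the infimum of
    [q (v + k) - s] over [C]. It is finite because [s <= q k <= q (v + k) + q (- v)], and at [- k]
    the pair [(k, s)] contributes [q 0 - s = - s]. *)
Lemma sublinear_descent q (C : V -> R -> Prop) :
  sublinear q -> C 0 0 ->
  (forall k s k' s', C k s -> C k' s' -> C (k + k') (s + s')) ->
  (forall a k s, 0 < a -> C k s -> C (a *: k) (a * s)) ->
  (forall k s, C k s -> s <= q k) ->
  exists q', [/\ sublinear q', forall v, q' v <= q v &
    forall k s, C k s -> q' (- k) <= - s].
Proof.
move=> qs C0 CD CZ Cq; have [qD qZ] := qs.
pose E v := [set r | exists k s, C k s /\ r = q (v + k) - s].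
have lbE v : lbound (E v) (- q (- v)).
  move=> _ [k [s [Cks ->]]]; have := qD (- v) (v + k).
  by rewrite addKr; have := Cq _ _ Cks; lra.
have infE v : has_inf (E v).
  split; last by exists (- q (- v)).
  by exists (q v), 0, 0; rewrite addr0 subr0.
have ple v k s : C k s -> inf (E v) <= q (v + k) - s.
  by move=> Cks; apply: ge_inf; [exact: (infE v).2 | exists k, s].
exists (fun v => inf (E v)); split => [|v|k s Cks].
- split=> [u v|a v a0].
  + apply/ler_addgt0Pr => e e0; have e2 : 0 < e / 2 by rewrite divr_gt0.
    have [_ [k [s [Ck ->]]] h1] := inf_adherent e2 (infE u).
    have [_ [k' [s' [Ck' ->]]] h2] := inf_adherent e2 (infE v).
    have := ple (u + v) _ _ (CD _ _ _ _ Ck Ck').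
    have := qD (u + k) (v + k').
    by rewrite (addrACA u); lra.
  + apply/ler_addgt0Pr => e e0; have e2 : 0 < e / a by rewrite divr_gt0.
    have [_ [k [s [Ck ->]]] h1] := inf_adherent e2 (infE v).
    have := ple (a *: v) _ _ (CZ _ _ _ a0 Ck).
    rewrite -scalerDr; have := qZ _ (v + k) a0.
    move: h1; rewrite -(ltr_pM2l a0) mulrDr mulrDr (mulrC a (e / a)) divfK
      ?gt_eqF//.
    by rewrite mulrN; lra.
- by have := ple v _ _ C0; rewrite addr0 subr0.
- by have := ple (- k) _ _ Cks; rewrite addNr sublinear0// sub0r.
Qed.

(** Zorn's lemma below [p]. A nonempty chain is bounded below by its pointwise infimum, finite since
    [- p (- v) <= f v]. This infimum is subadditive because, of two nearly optimal members, the
    smaller one serves both arguments. *)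
Lemma sublinear_minimal p : sublinear p ->
  exists q, [/\ sublinear q, forall v, q v <= p v &
    forall q', sublinear q' -> (forall v, q' v <= q v) -> forall v, q' v = q v].
Proof.
move=> ps.
pose P q := sublinear q /\ forall v, q v <= p v.
pose T := {q : V -> R | P q}.
(* The order is reversed, so that a maximal element is a minimal functional. *)
pose le (f g : T) := `[< forall v, sval g v <= sval f v >].
have [|f g h /asboolP fg /asboolP gh|f g /asboolP fg /asboolP gf|A totA|m mmax]
  :=
  @Zorn T le.
- by move=> f; apply/asboolP.
- by apply/asboolP => v; exact: le_trans (gh v) (fg v).
- apply: eq_sig_hprop => [? ? ?|]; first exact: Prop_irrelevance.
  apply/funext => v.
  by apply/eqP; rewrite eq_le fg gf.
- have [->|/set0P [f0 Af0]] := eqVneq A set0.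
    by exists (exist P p (conj ps (fun v => lexx _))).
  pose E v := [set sval f v | f in A].
  have infE v : has_inf (E v).
    split; first by exists (sval f0 v), f0.
    exists (- p (- v)) => _ [f Af <-]; have [fs fp] := svalP f.
    by apply: le_trans (sublinearN_ge _ v fs); rewrite lerN2.
  have ple f v : A f -> inf (E v) <= sval f v.
    by move=> Af; apply: ge_inf; [exact: (infE v).2 | exists f].
  have gP : sublinear (fun v => inf (E v)) /\ forall v, inf (E v) <= p v.
    split; last by move=> v; apply: le_trans (ple f0 v Af0) ((svalP f0).2 v).
    split=> [u v|a v a0].
    + apply/ler_addgt0Pr => e e0; have e2 : 0 < e / 2 by rewrite divr_gt0.
      have [_ [f Af <-] h1] := inf_adherent e2 (infE u).
      have [_ [g Ag <-] h2] := inf_adherent e2 (infE v).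
      have [/asboolP fg|/asboolP gf] := totA _ _ Af Ag.
      * have := (svalP g).1.1 u v; have := fg u; have := ple g (u + v) Ag; lra.
      * have := (svalP f).1.1 u v; have := gf v; have := ple f (u + v) Af; lra.
    + apply/ler_addgt0Pr => e e0; have e2 : 0 < e / a by rewrite divr_gt0.
      have [_ [f Af <-] h1] := inf_adherent e2 (infE v).
      have := ple f (a *: v) Af; have := (svalP f).1.2 a v a0.
      move: h1; rewrite -(ltr_pM2l a0) mulrDr (mulrC a (e / a)) divfK ?gt_eqF//.
      by lra.
  by exists (exist P _ gP) => f Af; apply/asboolP => v /=; exact: ple.
- exists (sval m); have [ms mp] := svalP m; split=> // q' q's q'm v.
  have q'p : sublinear q' /\ forall v, q' v <= p v.
    by split=> // u; exact: le_trans (q'm u) (mp u).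
  by rewrite -(mmax (exist P q' q'p))//; apply/asboolP.
Qed.

(* A minimal sublinear functional is odd: descending along the ray
   [{(t u, t q(u))}] does not change it, so [q (- u) <= - q u]. *)
Lemma sublinear_linear_minorant p (C : V -> R -> Prop) :
  sublinear p -> C 0 0 ->
  (forall k s k' s', C k s -> C k' s' -> C (k + k') (s + s')) ->
  (forall a k s, 0 < a -> C k s -> C (a *: k) (a * s)) ->
  (forall k s, C k s -> s <= p k) ->
  exists f : {linear V -> R^o},
    (forall v, f v <= p v) /\ (forall k s, C k s -> s <= f k).
Proof.
move=> ps C0 CD CZ Cp.
(* Any linear [f <= p'] satisfies [f (- k) <= - s], that is [s <= f k]: the constraints of [C]
   survive every further descent. *)
have [p' [p's p'p p'C]] := sublinear_descent _ _ ps C0 CD CZ Cp.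
have [q [qs qp' qmin]] := sublinear_minimal _ p's.
have qodd u : q (- u) <= - q u.
  pose Cu k s := exists t, [/\ 0 <= t, k = t *: u & s = t * q u].
  have [||||q' [q's q'q q'C]] := @sublinear_descent q Cu qs.
  - by exists 0; rewrite scale0r mul0r.
  - move=> _ _ _ _ [t [t0 -> ->]] [t' [t'0 -> ->]]; exists (t + t').
    by rewrite addr_ge0// scalerDl mulrDl.
  - move=> a _ _ a0 [t [t0 -> ->]]; exists (a * t).
    by rewrite mulr_ge0 ?(ltW a0)// scalerA mulrA.
  - move=> _ _ [t [t0 -> ->]]; move: t0; rewrite le_eqVlt => /predU1P[<-|t0].
      by rewrite scale0r mul0r sublinear0.
    have [_ qZ] := qs; have ti : 0 < t^-1 by rewrite invr_gt0.
    have := qZ _ (t *: u) ti; rewrite scalerA mulVf ?gt_eqF// scale1r.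
    by rewrite -(ler_pM2l t0) mulrA divff ?gt_eqF// mul1r.
  rewrite -(qmin _ q's q'q (- u)).
  by apply: q'C; exists 1; rewrite scale1r mul1r.
have ql := sublinear_odd _ qs qodd.
pose F := GRing.isLinear.Build R V R^o _ (q : V -> R^o) ql.
pose f : {linear V -> R^o} := HB.pack (q : V -> R^o) F.
exists f; split=> [v|k s Cks]; first exact: le_trans (qp' v) (p'p v).
have := qodd k; have := p'C _ _ Cks; have := qp' (- k).
have := sublinearN_ge _ k qs.
by rewrite /f /=; lra.
Qed.

End HahnBanach.

Arguments sublinear {R V} q.

(** * The Clarke derivative and the minimal norm of the gradient *)

Section Clarke.
Variables (R : realType) (X : normedModType R) (Phi : X -> R).
Implicit Types (x y u v w : X) (a b : R).

Lemma locally_lipschitz_ball x : locally_lipschitz Phi ->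
  exists L d : R, [/\ 0 <= L, 0 < d &
    forall u w, `|u - x| < d -> `|w - x| < d ->
      `|Phi u - Phi w| <= L * `|u - w|].
Proof.
move=> /(_ x) [U /nbhs_normP [d /= d0 dU] [M [_ HM]]].
exists (`|M| + 1), d; split=> // u w ux wx.
have := HM (`|M| + 1); rewrite (le_lt_trans (ler_norm M)) ?ltrDl//.
move=> /(_ isT (u, w)); apply; split; apply: dU => /=;
  by rewrite /ball_/= distrC.
Qed.

Lemma locally_lipschitz_continuous : locally_lipschitz Phi -> continuous Phi.
Proof.
move=> lip x; have [L [d [L0 d0 H]]] := locally_lipschitz_ball x lip.
apply/cvgrPdist_le => /= e e0; apply/nbhs_normP.
have L1 : 0 < L + 1 by rewrite ltr_wpDl.
exists (Num.min d (e / (L + 1))); first by rewrite /= lt_min d0 divr_gt0.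
move=> u /=; rewrite lt_min => /andP[xd xe].
apply: (le_trans (H _ _ _ _)); [by rewrite subrr normr0|by rewrite distrC|].
have : (L + 1) * `|x - u| <= e.
  by rewrite mulrC -ler_pdivlMr// ltW.
by apply: le_trans; rewrite ler_wpM2r// lerDl.
Qed.

(** A limsup is an infimum of suprema over neighbourhoods, so a strict bound already holds on one
    product neighbourhood. *)
Lemma clarke_dderiv_ltP x v a : (clarke_dderiv Phi x v < a%:E)%E ->
  exists2 d : R, 0 < d & forall w t, `|w - x| < d -> 0 < t -> t < d ->
    Phi (w + t *: v) - Phi w < t * a.
Proof.
move=> /ereal_inf_lt [_ [V [[Q1 Q2] /= [/nbhs_normP [d1 /= d10 dQ1]
  /nbhs_normP [d2 /= d20 dQ2]] QV] <-] lta].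
exists (Num.min d1 d2); first by rewrite lt_min d10.
move=> w t; rewrite !lt_min => /andP[wd1 _] t0 /andP[_ td2].
have VV : V (w, t).
  apply: QV; split => /=; first by apply: dQ1; rewrite /ball_/= distrC.
  by apply: dQ2 => //=; rewrite sub0r normrN gtr0_norm.
have := le_lt_trans (ereal_sup_ubound _) lta.
move=> /(_ _ (imageP _ VV)) /=; by rewrite lte_fin ltr_pdivrMr// mulrC.
Qed.

Lemma clarke_dderiv_le x v a d : 0 < d ->
  (forall w t, `|w - x| < d -> 0 < t -> t < d ->
    Phi (w + t *: v) - Phi w <= t * a) ->
  (clarke_dderiv Phi x v <= a%:E)%E.
Proof.
move=> d0 H.
apply: (@le_trans _ _ (ereal_sup
  [set ((Phi (wt.1 + wt.2 *: v) - Phi wt.1) / wt.2)%:E |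
     wt in [set wt : X * R | `|wt.1 - x| < d /\ 0 < wt.2 < d]])).
  apply: ereal_inf_lbound;
    exists [set wt : X * R | `|wt.1 - x| < d /\ 0 < wt.2 < d] => //.
  exists ([set w | `|w - x| < d], [set t | 0 < t < d]) => /=.
    split; first by apply/nbhs_normP; exists d => //= w; rewrite /= distrC.
    apply/nbhs_normP; exists d => //= t /=.
    by rewrite sub0r normrN => td t0; rewrite t0 (le_lt_trans (ler_norm t)).
  by move=> [w t] [].
apply: ub_ereal_sup => _ [[w t] /= [wx /andP[t0 td]] <-].
by rewrite lee_fin ler_pdivrMr// mulrC H.
Qed.

Lemma norm_shift_lt x u w (d t : R) : 0 < d -> `|w - x| < d / 2 ->
  0 < t -> t < d / 2 / (`|u| + 1) -> `|w + t *: u - x| < d.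
Proof.
move=> d0 wx t0; rewrite ltr_pdivlMr ?ltr_wpDl// => tu.
rewrite addrAC (le_lt_trans (ler_normD _ _))// normrZ gtr0_norm//.
have : t * `|u| <= t * (`|u| + 1) by rewrite ler_pM2l// lerDl.
lra.
Qed.

(** Upper semicontinuity in the base point: after halving the radius, the quotients near [y] are
    among those bounded near [x]. *)
Lemma clarke_dderiv_near_le x v a : (clarke_dderiv Phi x v < a%:E)%E ->
  \forall y \near x, (clarke_dderiv Phi y v <= a%:E)%E.
Proof.
move=> /clarke_dderiv_ltP [d d0 H]; have d2 : 0 < d / 2 by rewrite divr_gt0.
apply/nbhs_normP; exists (d / 2) => // y /= xy.
apply: (@clarke_dderiv_le _ _ _ _ d2) => w t wy t0 td.
apply/ltW/H => //; last by lra.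
have := ler_distD y w x; rewrite (distrC y x); lra.
Qed.

Hypothesis lip : locally_lipschitz Phi.

(** A derivative under the lower bound would make the increment at the base point [x] itself violate
    the Lipschitz estimate. Finiteness follows, so [fine] loses nothing. *)
Lemma clarke_dderiv_bounded x : exists2 L : R, 0 <= L &
  forall v, ((- (L * `|v|))%:E <= clarke_dderiv Phi x v)%E /\
            (clarke_dderiv Phi x v <= (L * `|v|)%:E)%E.
Proof.
have [L [d [L0 d0 H]]] := locally_lipschitz_ball x lip.
exists L => // v; split.
- rewrite leNgt; apply/negP => /clarke_dderiv_ltP [e e0 He].
  pose t := Num.min (e / 2) (d / 2 / (`|v| + 1)) / 2.
  have v1 : 0 < `|v| + 1 by rewrite ltr_wpDl.
  have t2 : 0 < Num.min (e / 2) (d / 2 / (`|v| + 1))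
    by rewrite lt_min !divr_gt0.
  have t0 : 0 < t by rewrite divr_gt0.
  have : t < Num.min (e / 2) (d / 2 / (`|v| + 1)) by rewrite /t; lra.
  rewrite lt_min => /andP[te td].
  have xx : `|x - x| < d / 2 by rewrite subrr normr0 divr_gt0.
  have xd : `|x - x| < d by rewrite subrr normr0.
  have xe : `|x - x| < e by rewrite subrr normr0.
  have tee : t < e by lra.
  have := H _ _ (norm_shift_lt _ _ _ _ _ d0 xx t0 td) xd.
  have := He _ _ xe t0 tee.
  rewrite [X in `|X - x|]addrC addrK normrZ gtr0_norm// => h1 /ler_normlP[h2 _].
  by move: h1 h2; rewrite mulrN (mulrCA t); lra.
- have v1 : 0 < `|v| + 1 by rewrite ltr_wpDl.
  apply: (@clarke_dderiv_le _ _ _ (Num.min (d / 2) (d / 2 / (`|v| + 1)))).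
    by rewrite lt_min !divr_gt0.
  move=> w t; rewrite !lt_min => /andP[wd _] t0 /andP[_ td].
  have wx : `|w - x| < d by lra.
  have := H _ _ (norm_shift_lt _ _ _ _ _ d0 wd t0 td) wx.
  rewrite [X in _ <= _ * `|X|]addrC addKr normrZ gtr0_norm// => /ler_normlP[_].
  by rewrite mulrCA.
Qed.

Let p x v := fine (clarke_dderiv Phi x v).

Lemma clarke_dderivE x v : (p x v)%:E = clarke_dderiv Phi x v.
Proof.
have [L _ /(_ v) [h1 h2]] := clarke_dderiv_bounded x.
by rewrite /p fineK// fin_numElt (lt_le_trans (ltNyr _) h1) (le_lt_trans h2
  (ltry _)).
Qed.

(** Subadditivity comes from the moving base point: the increment along [u + v] from [w] is one
    along [u] from [w] plus one along [v] from [w + t *: u], which is still near [x]. *)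
Lemma sublinear_clarke_dderiv x : sublinear (p x).
Proof.
split=> [u v|a v a0]; apply/ler_addgt0Pr => e e0.
- have e2 : 0 < e / 2 by rewrite divr_gt0.
  have /clarke_dderiv_ltP [d1 d10 H1] :
    (clarke_dderiv Phi x u < (p x u + e / 2)%:E)%E.
    by rewrite -clarke_dderivE lte_fin ltrDl.
  have /clarke_dderiv_ltP [d2 d20 H2] :
    (clarke_dderiv Phi x v < (p x v + e / 2)%:E)%E.
    by rewrite -clarke_dderivE lte_fin ltrDl.
  have u1 : 0 < `|u| + 1 by rewrite ltr_wpDl.
  rewrite -lee_fin clarke_dderivE.
  apply: (@clarke_dderiv_le _ _ _
    (Num.min (Num.min d1 d2) (Num.min (d2 / 2) (d2 / 2 / (`|u| + 1))))).
    by rewrite !lt_min d10 d20 !divr_gt0.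
  move=> w t; rewrite !lt_min => /andP[/andP[wd1 _] /andP[wd2 _]] t0
    /andP[/andP[td1 td2] /andP[_ td]].
  have := H2 _ _ (norm_shift_lt _ _ _ _ _ d20 wd2 t0 td) t0 td2.
  have := H1 _ _ wd1 t0 td1.
  by rewrite -addrA -scalerDr !mulrDr; lra.
- have ea : 0 < e / a by rewrite divr_gt0.
  have /clarke_dderiv_ltP [d d0 H] :
    (clarke_dderiv Phi x v < (p x v + e / a)%:E)%E.
    by rewrite -clarke_dderivE lte_fin ltrDl.
  rewrite -lee_fin clarke_dderivE.
  apply: (@clarke_dderiv_le _ _ _ (Num.min d (d / a)));
    first by rewrite lt_min d0 divr_gt0.
  move=> w t; rewrite !lt_min => /andP[wd _] t0 /andP[_];
    rewrite ltr_pdivlMr// => td.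
  have := H _ _ wd (mulr_gt0 t0 a0) td.
  rewrite -scalerA => /ltW; congr (_ <= _).
  by rewrite -mulrA mulrDr mulrCA divff ?gt_eqF// mulr1.
Qed.

Lemma clarke_dderiv_ge_norm x (m : R) :
  (forall v, `|v| <= 1 -> ((- m)%:E <= clarke_dderiv Phi x v)%E) ->
  forall v, ((- (m * `|v|))%:E <= clarke_dderiv Phi x v)%E.
Proof.
move=> H v; have [->|v0] := eqVneq v 0.
  by rewrite normr0 mulr0 oppr0 -clarke_dderivE lee_fin (sublinear0 _ _ _
    (sublinear_clarke_dderiv x)).
have nv : 0 < `|v| by rewrite normr_gt0.
have ni : 0 < `|v|^-1 by rewrite invr_gt0.
have := H (`|v|^-1 *: v);
  rewrite normrZ gtr0_norm// mulVf ?gt_eqF// lexx => /(_ isT).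
rewrite -!clarke_dderivE !lee_fin => h.
have := (sublinear_clarke_dderiv x).2 _ v ni; move=> /(le_trans h).
by rewrite -(ler_pM2l nv) mulrA divff ?gt_eqF// mul1r mulrN mulrC.
Qed.

(* The least dual norm is the steepest descent rate
   [m = sup_(|v| <= 1) (- Phi^0(x, v))]: every [f <= Phi^0(x, .)] has norm at
   least [m], and a Hahn-Banach minorant above [- m |.|] has norm at most [m]. *)
Lemma clarke_gradient_min_norm x : exists m : R,
  [/\ 0 <= m, is_min [set dual_norm f | f in clarke_gradient Phi x] m,
      forall v, ((- (m * `|v|))%:E <= clarke_dderiv Phi x v)%E &
      forall e : R, 0 <= e ->
        (forall v, `|v| <= 1 -> ((- e)%:E <= clarke_dderiv Phi x v)%E) ->
          m <= e].
Proof.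
have [L L0 HL] := clarke_dderiv_bounded x.
(* The nonnegative upper bounds of [- Phi^0(x, v)] on the unit ball; the infimum of [S] is the
   descent rate. *)
pose S := [set e : R | 0 <= e /\
  forall v, `|v| <= 1 -> ((- e)%:E <= clarke_dderiv Phi x v)%E].
have SL : S L.
  split=> // v v1; apply: le_trans (HL v).1; rewrite lee_fin lerN2.
  by rewrite ler_piMr.
have Slb : has_lbound S by exists 0 => e [].
have m0 : 0 <= inf S by apply: lb_le_inf; [exists L|move=> e []].
have mmin e : 0 <= e ->
    (forall v, `|v| <= 1 -> ((- e)%:E <= clarke_dderiv Phi x v)%E) ->
      inf S <= e.
  by move=> e0 He; apply: ge_inf.
have mp v : ((- (inf S * `|v|))%:E <= clarke_dderiv Phi x v)%E.
  apply: clarke_dderiv_ge_norm => {}v v1; rewrite -clarke_dderivE lee_fin lerNl.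
  apply: lb_le_inf; first by exists L.
  by move=> e [_ /(_ v v1)]; rewrite -clarke_dderivE lee_fin lerNl.
(* The bound [L] makes the [sup] in [dual_norm] a genuine supremum. *)
have grad_norm (f : {linear X -> R^o}) : clarke_gradient Phi x f ->
    forall v, `|v| <= 1 -> `|f v : R| <= dual_norm f.
  move=> [_ fp] v v1; apply: sup_upper_bound; last by exists v.
  split; first by exists `|f 0 : R|, 0 => //=; rewrite normr0.
  exists L => _ [u /= u1 <-]; apply: (@le_trans _ _ (L * `|u|));
    last by rewrite ler_piMr.
  apply/ler_normlP; split.
    rewrite -[- _]/(- (f u)) -linearN -lee_fin -(normrN u).
    exact: le_trans (fp (- u)) (HL (- u)).2.
  by rewrite -lee_fin; exact: le_trans (fp u) (HL u).2.
(* This hypograph is a convex cone, and [mp] puts it below [Phi^0(x, .)]; it forces the minorant to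
   have norm at most [inf S]. *)
pose C (k : X) (s : R) := s <= - (inf S * `|k|).
have [||||f [fp fC]] :=
  @sublinear_linear_minorant R X (p x) C (sublinear_clarke_dderiv x).
- by rewrite /C normr0 mulr0 oppr0.
- move=> k s k' s' h h'; apply: (le_trans (lerD h h')).
  by rewrite -opprD lerN2 -mulrDr ler_wpM2l// ler_normD.
- move=> a k s a0 h; rewrite /C normrZ gtr0_norm// mulrCA -mulrN.
  by rewrite ler_pM2l.
- by move=> k s h; apply: (le_trans h); rewrite -lee_fin clarke_dderivE.
have fm v : `|f v : R| <= inf S * `|v|.
  have fge w : - (inf S * `|w|) <= f w by apply: fC; exact: lexx.
  apply/ler_normlP; split; last first.
    by have := fge (- v); rewrite linearN normrN lerN2.
  by rewrite lerNl.
have fgrad : clarke_gradient Phi x f.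
  split; last by move=> v; rewrite -clarke_dderivE lee_fin.
  move=> u; apply/cvgrPdist_le => /= e e0; apply/nbhs_normP.
  have S1 : 0 < inf S + 1 by rewrite ltr_wpDl.
  exists (e / (inf S + 1)); first by rewrite /= divr_gt0.
  move=> w /=; rewrite ltr_pdivlMr// => we.
  rewrite -linearB (le_trans (fm _))//; apply/ltW/(le_lt_trans _ we).
  by rewrite mulrC ler_wpM2l// lerDl.
have mle (g : {linear X -> R^o}) : clarke_gradient Phi x g ->
  inf S <= dual_norm g.
  move=> gg; apply: mmin => [|v v1].
    by apply: le_trans (grad_norm g gg 0 _); rewrite ?normr0.
  apply: le_trans (gg.2 v); rewrite lee_fin lerNl.
  apply: le_trans (grad_norm g gg v v1).
  by rewrite -normrN ler_norm.
exists (inf S); split=> //; split; last by move=> _ [g gg <-]; exact: mle.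
exists f => //; apply/eqP; rewrite eq_le mle// andbT.
apply: ge_sup; first by exists `|f 0 : R|, 0 => //=; rewrite normr0.
move=> _ [v /= v1 <-]; apply: (le_trans (fm v)).
by rewrite ler_piMr.
Qed.

End Clarke.

(** * The geodesic distance along a segment *)

Section Geodesic.
Variables (R : realType) (X : normedModType R).
Implicit Types (x y : X) (t : R).

(** Makes the limit in [velocity] unique, at the end points too: a step of length at most 1/2
    towards the farther end point stays in the interval. *)
Lemma within_unit_dnbhs_proper t : t \in `[0, 1] ->
  ProperFilter (within `[0, 1] t^').
Proof.
rewrite in_itv/= => /andP[t0 t1].
apply: Build_ProperFilter_ex => B /nbhs_normP [e /= e0 eB].
pose d := Num.min e 1 / 2.
have : 0 < Num.min e 1 by rewrite lt_min e0 ltr01.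
have : Num.min e 1 <= e by rewrite ge_min lexx.
have : Num.min e 1 <= 1 by rewrite ge_min lexx orbT.
move=> m1 me m0.
have dE : d = Num.min e 1 / 2 by [].
have [th|th] := leP t 2^-1.
- exists (t + d); apply: eB => /=.
  + by rewrite opprD addrA subrr sub0r normrN gtr0_norm; lra.
  + by apply/eqP => h; lra.
  + by rewrite in_itv/=; apply/andP; split; lra.
- exists (t - d); apply: eB => /=.
  + by rewrite opprB addrC subrK gtr0_norm; lra.
  + by apply/eqP => h; lra.
  + by rewrite in_itv/=; apply/andP; split; lra.
Qed.

Definition segment x y t : X := x + t *: (y - x).

Lemma continuous_segment x y : continuous (segment x y).
Proof.
by move=> t; apply: cvgD; [exact: cvg_cst|apply: cvgZr_tmp; exact: cvg_id].
Qed.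

Lemma segment_quotient_cvg x y t :
  (s - t)^-1 *: (segment x y s - segment x y t) @[s --> within `[0,
    1] t^'] --> y - x.
Proof.
apply: cvg_near_cst; rewrite near_withinE /dnbhs near_withinE; near=> s => st _.
rewrite /segment opprD addrACA subrr add0r -scalerBl scalerA mulVf ?scale1r//.
by rewrite subr_eq0.
Unshelve. all: by end_near. Qed.

Lemma velocity_segment x y t : t \in `[0, 1] ->
  velocity (segment x y) t = y - x.
Proof.
move=> t01; have ? := within_unit_dnbhs_proper t t01.
by apply: cvg_lim; [exact: norm_hausdorff|exact: segment_quotient_cvg].
Qed.

Lemma C1_curve_segment x y : C1_curve (segment x y).
Proof.
split=> [t t01|].
  by apply/cvg_ex; exists (y - x); exact: segment_quotient_cvg.
apply: (@subspace_eq_continuous _ _ _ (fun=> y - x)).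
  by move=> t; rewrite inE/= => t01; rewrite /from_subspace velocity_segment.
by move=> t; exact: cvg_cst.
Qed.

Lemma curve_length_ge0 (c : R -> X) : (0 <= curve_length c)%E.
Proof. by apply: integral_ge0 => t _; rewrite lee_fin divr_ge0// addr_ge0. Qed.

(** The norm on the segment is at least [|x| - |x - y|], which bounds the integrand by a
    constant. *)
Lemma curve_length_segment_le x y :
  `|x - y| < 1 + `|x| ->
  (curve_length (segment x y) <= (`|x - y| / (1 + `|x| - `|x - y|))%:E)%E.
Proof.
move=> xy.
have -> : curve_length (segment x y) = (\int[lebesgue_measure]_(t in `[0%R,
  1%R])
    (`|y - x| / (1 + `|segment x y t|))%:E)%E.
  by apply: eq_integral => t; rewrite inE/= => t01; rewrite velocity_segment.
apply: (@le_trans _ _ (\int[lebesgue_measure]_(t in `[0%R, 1%R])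
    (cst (`|x - y| / (1 + `|x| - `|x - y|))%:E t))%E); last first.
  rewrite integral_cst//= lebesgue_measure_itv/= lte_fin ltr01 sube0 mule1.
  exact: lexx.
apply: ge0_le_integral => //.
- apply/measurable_EFinP; apply: measurable_funTS.
  apply: continuous_measurable_fun => t; apply: cvgM; first exact: cvg_cst.
  apply: cvgV; first by rewrite gt_eqF// ltr_wpDr.
  apply: cvgD; first exact: cvg_cst.
  by apply: cvg_norm; exact: continuous_segment.
- move=> t /=; rewrite in_itv/= => /andP[t0 t1].
  rewrite lee_fin (distrC y) ler_wpM2l//.
  have h1 : 0 < 1 + `|x| - `|x - y| by lra.
  have h2 : 0 < 1 + `|segment x y t| by rewrite ltr_wpDr.
  rewrite lef_pV2//.
  have : `|x| <= `|segment x y t| + `|t *: (y - x)|.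
    by rewrite -{1}(addrK (t *: (y - x)) x) ler_normB.
  have : `|t *: (y - x)| <= `|x - y|.
    by rewrite normrZ ger0_norm// distrC ler_piMl.
  lra.
Qed.

Lemma geodesic_setdist_ge0 x (F : set X) : (0 <= geodesic_setdist x F)%E.
Proof.
apply: le_ereal_inf_tmp => _ [y _ <-]; apply: le_ereal_inf_tmp => _ [c _ <-].
exact: curve_length_ge0.
Qed.

(** Since [r <= 1/2], the denominator [1 + |x| - |x - y|] of the segment estimate is at least half
    of [1 + |x|]; hence the factor 2. *)
Lemma geodesic_setdist_le x y (F : set X) (r : R) : F y -> r <= 2^-1 ->
  `|x - y| <= r * (1 + `|x|) -> (geodesic_setdist x F <= (2 * r)%:E)%E.
Proof.
move=> Fy r2 xyr.
have x1 : 0 < 1 + `|x| by rewrite ltr_wpDr.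
have h : r * (1 + `|x|) <= 2^-1 * (1 + `|x|) by rewrite ler_pM2r.
have xy : `|x - y| < 1 + `|x| by lra.
apply: (@le_trans _ _ (geodesic_dist x y)).
  by apply: ereal_inf_lbound; exists y.
apply: (@le_trans _ _ (curve_length (segment x y))).
  apply: ereal_inf_lbound; exists (segment x y) => //; split.
  - exact: C1_curve_segment.
  - by rewrite /segment scale0r addr0.
  - by rewrite /segment scale1r addrC subrK.
apply: le_trans (curve_length_segment_le _ _ xy) _.
rewrite lee_fin ler_pdivrMr; last by lra.
apply: (le_trans xyr).
have r0 : 0 <= r.
  by have := le_trans (normr_ge0 _) xyr; rewrite pmulr_lge0.
rewrite [2 * r]mulrC -mulrA ler_wpM2l//; lra.
Qed.

End Geodesic.

(** * Maximal elements, uniform limits and local pushes of a curve *)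

Lemma invS_lt (R : realType) (e : R) : 0 < e -> exists n : nat, n.+1%:R^-1 < e.
Proof.
move=> e0; exists (Num.trunc e^-1).
by rewrite invf_plt ?posrE// truncnS_gt.
Qed.

(* Brezis-Browder: if each point of a sequence comes within [1 / n.+1] of the
   supremum of [f] above its predecessor, any upper bound is maximal for [f]. *)
Lemma exists_maximal_above (R : realType) (T : Type) (D : T -> Prop)
    (le : T -> T -> Prop) (f : T -> R) (M : R) (x : T) :
  (forall y, le y y) ->
  (forall y z u, le y z -> le z u -> le y u) ->
  (forall y z, le y z -> f y <= f z) ->
  (forall y, D y -> f y <= M) ->
  (forall s : nat -> T, (forall n, D (s n)) -> (forall n, le (s n) (s n.+1)) ->
    exists2 y, D y & forall n, le (s n) y) ->
  D x ->
  exists y, [/\ D y, le x y & forall z, D z -> le y z -> f z <= f y].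
Proof.
move=> le_refl le_trans_ fle fM lub Dx.
pose E y := [set f z | z in [set z | D z /\ le y z]].
have supE y : D y -> has_sup (E y).
  move=> Dy; split; first by exists (f y), y.
  by exists M => _ [z [Dz _] <-]; exact: fM.
have /choice [g gP] : forall ny : nat * T, exists z, D ny.2 ->
    [/\ D z, le ny.2 z & sup (E ny.2) - ny.1.+1%:R^-1 < f z].
  move=> [n y]; have [Dy|nDy] := pselect (D y); last by exists y.
  have n0 : 0 < n.+1%:R^-1 :> R by rewrite invr_gt0.
  have [_ [z [Dz yz] <-] h] := sup_adherent n0 (supE y Dy).
  by exists z.
pose s := fix s n := if n is n'.+1 then g (n', s n') else x.
have Ds n : D (s n) by elim: n => //= n Dn; have [] := gP (n, s n) Dn.
have les n : le (s n) (s n.+1) by have [] := gP (n, s n) (Ds n).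
have [y Dy ley] := lub s Ds les.
exists y; split=> // [|z Dz yz]; first exact: ley 0%N.
(* As [z] lies above [s n], [f z] is at most the supremum there, which exceeds [f (s n.+1) <= f y]
   by less than [1 / n.+1]. *)
apply/ler_addgt0Pr => e e0; have [n ne] := invS_lt _ _ e0.
have h : sup (E (s n)) - n.+1%:R^-1 < f (g (n, s n)) by have [] :=
  gP (n, s n) (Ds n).
have h1 : f z <= sup (E (s n)).
  apply: sup_upper_bound; first exact: supE.
  by exists z => //; split=> //; exact: le_trans_ yz.
have h2 : f (g (n, s n)) <= f y := fle _ _ (ley n.+1).
by move: ne h; move: n.+1%:R^-1 => q; lra.
Qed.

Section UniformLimit.
Variables (R : realType) (X : completeNormedModType R).

(** The bounded monotone [tau] controls the increments of the curves, so these are Cauchy at each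
    parameter. As [w] is locally bounded, convergence is locally uniform and the limit is
    continuous. *)
Lemma weighted_uniform_limit (c : nat -> R -> X) (tau : nat -> R) (w : R ->
  R) (T : R) :
  (forall n, continuous (c n)) -> continuous w -> (forall t, 0 <= w t) ->
  (forall n, tau n <= T) ->
  (forall n m, (n <= m)%N -> tau n <= tau m) ->
  (forall n m, (n <= m)%N ->
    forall t, `|c m t - c n t| <= (tau m - tau n) * w t) ->
  exists d : R -> X, exists l : R,
    [/\ continuous d, forall t, c n t @[n --> \oo] --> d t,
        tau n @[n --> \oo] --> l, forall n, tau n <= l &
        forall n t, `|d t - c n t| <= (l - tau n) * w t].
Proof.
move=> cc wc w0 tauT tau_le c_le.
have tau_cvg : cvgn tau.
  by apply: nondecreasing_is_cvgn; [move=> n m;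
    exact: tau_le|exists T => _ [n _ <-]].
pose l := limn tau.
have taul n : tau n <= l by apply: nondecreasing_cvgn_le => // ? ?;
  exact: tau_le.
have tau_near e : 0 < e -> exists n, l - tau n < e.
  move=> e0; have /cvgrPdist_lt /(_ e e0) [N _ HN] := tau_cvg.
  by exists N; have := HN N (leqnn N); apply: le_lt_trans; exact: ler_norm.
have c_near n m t : (n <= m)%N -> `|c m t - c n t| <= (l - tau n) * w t.
  by move=> nm; apply: le_trans (c_le _ _ nm t) _; rewrite ler_wpM2r// lerD2r.
(* The [+ 1] avoids dividing by a vanishing weight and leaves room for [w s <= w t + 1] at nearby
   [s]. *)
have small_gap e t : 0 < e -> exists n, (l - tau n) * (w t + 1) < e.
  move=> e0; have w1 : 0 < w t + 1 by rewrite ltr_wpDl.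
  have [n] := tau_near (e / (w t + 1)) (divr_gt0 e0 w1).
  by rewrite ltr_pdivlMr// => h; exists n.
have c_cvg t : cvgn (c ^~ t).
  apply/cauchy_cvgP/cauchy_exP => e e0.
  have [n ne] := small_gap e t e0; exists (c n t), n => // m /= nm.
  rewrite /= -ball_normE /= distrC; apply: le_lt_trans (c_near _ _ _ nm) _.
  by apply: le_lt_trans ne; rewrite ler_wpM2l ?subr_ge0// lerDl.
pose d t := limn (c ^~ t).
have dist n t : `|d t - c n t| <= (l - tau n) * w t.
  apply/ler_addgt0Pr => e e0.
  have /cvgrPdist_lt /(_ e e0) [N _ HN] := c_cvg t.
  have := HN (maxn n N) (leq_maxr _ _); have := c_near _ _ t (leq_maxl n N).
  by have := ler_distD (c (maxn n N) t) (d t) (c n t); rewrite /d; lra.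
exists d, l; split=> // t; apply/cvgrPdist_lt => /= e e0.
have e3 : 0 < e / 3 by rewrite divr_gt0.
have [n ne] := small_gap (e / 3) t e3.
have /cvgrPdist_lt /(_ (e / 3) e3) := cc n t;
  have /cvgrPdist_lt /(_ 1 ltr01) := wc t.
apply: filterS2 => s /= ws cs.
have wst : w s <= w t + 1.
  by have := ler_norm (w s - w t); rewrite distrC; lra.
have h0 : 0 <= l - tau n by rewrite subr_ge0.
have h1 : (l - tau n) * w s <= (l - tau n) * (w t + 1) by rewrite ler_wpM2l.
have h2 : (l - tau n) * w t <= (l - tau n) * (w t + 1)
  by rewrite ler_wpM2l// lerDl.
have := ler_distD (c n t) (d t) (d s); have := ler_distD (c n s) (c n t) (d s).
have := dist n t; have := dist n s; rewrite (distrC (d s)).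
lra.
Qed.

End UniformLimit.

Section Push.
Variables (R : realType) (X : normedModType R) (Phi : X -> R).
Implicit Types (c : R -> X) (w : R -> R) (A : set R).

Lemma continuous_maxr (f g : R -> R) : continuous f -> continuous g ->
  continuous (fun t => Num.max (f t) (g t)).
Proof.
move=> cf cg t; under eq_fun do rewrite maxr_absE.
apply: cvgMr_tmp; apply: cvgD; first (by apply: cvgD; [exact: cf|exact: cg]).
by apply: cvg_norm; apply: cvgB; [exact: cf|exact: cg].
Qed.

Lemma continuous_minr (f g : R -> R) : continuous f -> continuous g ->
  continuous (fun t => Num.min (f t) (g t)).
Proof.
move=> cf cg t; under eq_fun do rewrite minr_absE.
apply: cvgMr_tmp; apply: cvgB; first (by apply: cvgD; [exact: cf|exact: cg]).
by apply: cvg_norm; apply: cvgB; [exact: cf|exact: cg].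
Qed.

(** Here [sigma] is the time already spent at parameter [t] and [s] the time added by a push along
    [v]. Quantifying over all displaced points [x] lets the pushes of overlapping cells be
    composed. *)
Definition descent_cell c w A (a k t0 r rho : R) (v : X) : Prop :=
  forall t x sigma s, t \in `[0, 1] -> A t -> `|t - t0| < r ->
    `|x - c t| <= rho * w t -> 0 <= sigma -> 0 <= s -> sigma + s <= rho ->
    Phi x <= a - k * sigma -> Phi (x + (s * w t) *: v) <= a - k * (sigma + s).

Definition bump (h t0 r t : R) : R :=
  h * Num.min 1 (Num.max 0 (2 - 2 * (`|t - t0| / r))).

Lemma continuous_bump h t0 r : continuous (bump h t0 r).
Proof.
move=> t; apply: cvgMl_tmp; move: t; apply: (@continuous_minr (fun=> 1)).
  by move=> t; exact: cvg_cst.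
apply: (@continuous_maxr (fun=> 0)) => t; first exact: cvg_cst.
apply: cvgB; first exact: cvg_cst.
apply: cvgMl_tmp; apply: cvgMr_tmp; apply: cvg_norm.
by apply: cvgB; [exact: cvg_id|exact: cvg_cst].
Qed.

Lemma bump_le h t0 r t : 0 <= h -> bump h t0 r t <= h.
Proof. by move=> h0; rewrite /bump ler_piMr// ge_min lexx. Qed.

Lemma bump_out h t0 r t : 0 < r -> r <= `|t - t0| -> bump h t0 r t = 0.
Proof.
move=> r0 rt; rewrite /bump.
have : 1 <= `|t - t0| / r by rewrite ler_pdivlMr// mul1r.
move=> h1; rewrite max_l; last by lra.
by rewrite min_r ?ler01// mulr0.
Qed.

Lemma bump_in h t0 r t : 0 < r -> `|t - t0| < r / 2 -> bump h t0 r t = h.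
Proof.
move=> r0 rt; rewrite /bump.
have : `|t - t0| / r < 2^-1 by rewrite ltr_pdivrMr// mulrC.
move=> h1; rewrite max_r; last by lra.
by rewrite min_l ?mulr1//; lra.
Qed.

(** Induction on the cells. Each one raises the elapsed time to the maximum of its old value and a
    bump of height [h], and moves the curve only by the difference. Overlaps thus never exceed [h],
    and points already moved stay within the range [rho] of the next cell. *)
Lemma push_along_cells c w A (a k h : R) (r rho : R -> R) (v : R ->
  X) (l : seq R) :
  continuous c -> continuous w -> (forall t, 0 <= w t) -> 0 < h ->
  (forall t, t \in `[0, 1] -> A t -> Phi (c t) <= a) ->
  (forall t0, t0 \in l -> [/\ 0 < r t0, h <= rho t0, `|v t0| <= 1,
     v t0 = 0 \/ r t0 <= t0 <= 1 - r t0 &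
     descent_cell c w A a k t0 (r t0) (rho t0) (v t0)]) ->
  exists (c' : R -> X) (sigma : R ->
    R), [/\ continuous c', continuous sigma, c' 0 = c 0 /\ c' 1 = c 1 &
    [/\ forall t, 0 <= sigma t <= h,
        forall t, `|c' t - c t| <= sigma t * w t,
        forall t, t \in `[0, 1] -> A t -> Phi (c' t) <= a - k * sigma t &
        forall t0 t, t0 \in l -> `|t - t0| < r t0 / 2 -> sigma t = h]].
Proof.
move=> cc wc w0 h0 ca; elim: l => [_|t0 l IH Hl].
  exists c, (fun=> 0); split=> //; first by move=> t; exact: cvg_cst.
  split=> // t; first by rewrite lexx ltW.
    by rewrite subrr normr0 mul0r.
  by move=> t01 At; rewrite mulr0 subr0 ca.
have [t1 t1l|c1 [s1 [c1c s1c [c10 c11] [s1h c1s1 c1A s1l]]]] := IH.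
  by apply: Hl; rewrite in_cons t1l orbT.
have [r0 hrho v1 v0 cell] := Hl t0 (mem_head _ _).
pose s2 t := Num.max (s1 t) (bump h t0 (r t0) t).
have s12 t : s1 t <= s2 t by rewrite le_max lexx.
have s2h t : s2 t <= h by rewrite ge_max (andP (s1h t)).2 bump_le// ltW.
have s10 t : 0 <= s1 t by have /andP[] := s1h t.
have s2_out t : r t0 <= `|t - t0| -> s2 t = s1 t.
  by move=> rt; rewrite /s2 bump_out// max_l.
pose c2 t := c1 t + ((s2 t - s1 t) * w t) *: v t0.
have c2_out t : r t0 <= `|t - t0| -> c2 t = c1 t.
  by move=> rt; rewrite /c2 s2_out// subrr mul0r scale0r addr0.
have s2c : continuous s2.
  by apply: continuous_maxr => //; exact: continuous_bump.
exists c2, s2; split=> //.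
- move=> t; apply: cvgD; first exact: c1c.
  apply: cvgZr_tmp; apply: cvgM; last exact: wc.
  by apply: cvgB; [exact: s2c|exact: s1c].
(* The end points stay fixed: either nothing moves, or the support of the bump excludes 0 and 1. *)
- case: v0 => [v0|/andP[rt0 rt1]].
    by rewrite /c2 v0 !scaler0 !addr0.
  rewrite !c2_out//; last by rewrite sub0r normrN (le_trans rt0)// ler_norm.
  by rewrite (le_trans _ (ler_norm _))// lerBrDl addrC -lerBrDl.
- split=> [t|t|t t01 At|t1 t].
  + by rewrite s2h andbT (le_trans (s10 t)).
  + have -> : c2 t - c t = (c1 t - c t) + ((s2 t - s1 t) * w t) *: v t0.
      by rewrite /c2 addrAC.
    apply: le_trans (ler_normD _ _) _; rewrite normrZ ger0_norm; last first.
      by rewrite mulr_ge0// subr_ge0.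
    have : (s2 t - s1 t) * w t * `|v t0| <= (s2 t - s1 t) * w t.
      by rewrite ler_piMr// mulr_ge0// subr_ge0.
    by have := c1s1 t; rewrite mulrBl; lra.
  + have [rt|rt] := leP (r t0) `|t - t0|;
      first by rewrite c2_out// s2_out// c1A.
    have -> : s2 t = s1 t + (s2 t - s1 t) by rewrite addrC subrK.
    apply: cell => //; rewrite ?subr_ge0//; last exact: c1A.
      apply: le_trans (c1s1 t) _; rewrite ler_wpM2r//.
      by rewrite (le_trans _ hrho)//; have /andP[] := s1h t.
    by rewrite addrC subrK (le_trans (s2h t)).
  + rewrite in_cons => /predU1P[->|t1l] rt.
      by rewrite /s2 bump_in// max_r//; have /andP[] := s1h t.
    have s1t := s1l _ _ t1l rt.
    by apply/eqP; rewrite eq_le s2h -{1}s1t s12.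
Qed.

(** By compactness finitely many balls of half radius cover the interval. Bumps are full on them, so
    every parameter advances by the same [h], the least of [h0] and the finitely many [rho]. *)
Lemma push_curve c w A (a k h0 : R) :
  continuous c -> continuous w -> (forall t, 0 <= w t) -> 0 < h0 ->
  (forall t, t \in `[0, 1] -> A t -> Phi (c t) <= a) ->
  (forall t0, t0 \in `[0, 1] ->
    exists (r rho : R) (v : X), [/\ 0 < r, 0 < rho, `|v| <= 1,
     v = 0 \/ r <= t0 <= 1 - r & descent_cell c w A a k t0 r rho v]) ->
  exists (h : R) (c' : R ->
    X), [/\ 0 < h <= h0, continuous c', c' 0 = c 0 /\ c' 1 = c 1,
    forall t, `|c' t - c t| <= h * w t &
    forall t, t \in `[0, 1] -> A t -> Phi (c' t) <= a - k * h].
Proof.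
move=> cc wc w0 h00 ca cells.
have /choice [g gP] : forall t0, exists q : R * R * X, t0 \in `[0, 1] ->
    [/\ 0 < q.1.1, 0 < q.1.2, `|q.2| <= 1, q.2 = 0 \/ q.1.1 <= t0 <= 1 - q.1.1 &
        descent_cell c w A a k t0 q.1.1 q.1.2 q.2].
  move=> t0; have [t01|] := pselect (t0 \in `[0, 1]); last by exists (0, 0, 0).
  by have [r [rho [v H]]] := cells t0 t01; exists (r, rho, v).
have := @segment_compact R 0 1; rewrite compact_cover.
move=> /(_ R `[0,
  1]%classic (fun t0 => ball t0 ((g t0).1.1 / 2))) [||D DI cover].
- by move=> t0 t01; have [r0 _ _ _ _] := gP t0 t01; apply: ball_open;
    rewrite divr_gt0.
- move=> t t01; have [r0 _ _ _ _] := gP t t01; exists t => //.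
  by apply: ballxx; rewrite divr_gt0.
pose l := finmap.enum_fset D.
have lI t0 : t0 \in l -> t0 \in `[0, 1].
  by move=> /DI; rewrite inE.
have [h [hpos hl]] : exists h, 0 < h <= h0 /\ forall t0, t0 \in l ->
  h <= (g t0).1.2.
  elim: (l) lI => [_|t0 l' IH lI].
    by exists h0; rewrite h00 lexx.
  have [|h [/andP[h1 h2] hl]] := IH.
    by move=> t1 t1l; apply: lI; rewrite in_cons t1l orbT.
  have [_ rho0 _ _ _] := gP t0 (lI _ (mem_head _ _)).
  exists (Num.min h (g t0).1.2); rewrite lt_min h1 rho0 ge_min h2;
    split=> // t1.
  by rewrite in_cons ge_min => /predU1P[->|/hl ->//]; rewrite lexx orbT.
have /andP[h_gt0 hh0] := hpos.
have [|c' [s [c'c sc c'01 [sh c's c'A sl]]]] := @push_along_cells c w A a k h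
   (fun t => (g t).1.1) (fun t => (g t).1.2) (fun t => (g t).2) l cc wc w0
     h_gt0 ca.
  move=> t0 t0l; have [r0 rho0 v1 v0 cell] := gP t0 (lI _ t0l).
  by split=> //; exact: hl.
exists h, c'; split=> // [t|t t01 At].
  apply: le_trans (c's t) _; rewrite ler_wpM2r//.
  by have /andP[] := sh t.
have [t0 /= t0D tt0] := cover t t01.
have <- : s t = h.
  by apply: (sl t0) => //; move: tt0; rewrite -ball_normE /= distrC.
exact: c'A.
Qed.

End Push.

Arguments descent_cell {R X}.

(** * Deformation of a curve *)

Section Deformation.
Variables (R : realType) (X : completeNormedModType R) (Phi : X -> R).
Implicit Types (c : R -> X) (A : set R).

(** Adherence to [A] within the unit interval. Every cell around such a [t0] meets [A], even if [t0]
    itself is outside. *)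
Definition unit_cluster A (t0 : R) : Prop :=
  forall r, 0 < r -> exists t, [/\ t \in `[0, 1], A t & `|t - t0| < r].

(** Moving along [v] at speed [w t0] lowers [Phi] at a rate above [k]; strictness lets this persist
    nearby. The parameter is interior because the end points must not move. *)
Definition steep (w : R -> R) (k : R) c (t0 : R) : Prop :=
  0 < t0 < 1 /\ exists (v : X) (b : R),
    [/\ `|v| <= 1, 0 < b, (clarke_dderiv Phi (c t0) v < (- b)%:E)%E &
      k < b * w t0].

(** Away from [A] the cell is vacuous. Below the level [a], [v = 0] works while [k * rho] is at most
    half the gap. At the level, steepness gives [v]. Above it, continuity contradicts the bound on
    [A]. *)
Lemma exists_descent_cell c (w : R -> R) A (a k t0 : R) :
  continuous Phi -> continuous c -> continuous w -> 0 < k ->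
    (forall t, 0 <= w t) ->
  (forall t, t \in `[0, 1] -> A t -> Phi (c t) <= a) ->
  (unit_cluster A t0 -> Phi (c t0) = a -> steep w k c t0) ->
  exists (r rho : R) (v : X), [/\ 0 < r, 0 < rho, `|v| <= 1,
     v = 0 \/ r <= t0 <= 1 - r & descent_cell Phi c w A a k t0 r rho v].
Proof.
move=> cPhi cc wc k0 w0 ca Hsteep.
have near_radius (P : R -> Prop) : (\forall t \near t0, P t) ->
    exists2 r, 0 < r & forall t, `|t - t0| < r -> P t.
  move=> /nbhs_normP [r /= r0 Pr]; exists r => // t tr.
  by apply: Pr => /=; rewrite /ball_/= distrC.
have [clA|] := pselect (unit_cluster A t0); last first.
  move=> nA; have [r [r0 Ar]] : exists r, 0 < r /\
      forall t, t \in `[0, 1] -> A t -> ~ (`|t - t0| < r).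
    apply: contrapT => h; apply: nA => r r0; apply: contrapT => h'; apply: h.
    by exists r; split=> // t t01 At tr; apply: h'; exists t.
  exists r, 1, 0; split=> //; first by rewrite normr0.
    by left.
  by move=> t x sigma s t01 At /(Ar t t01 At).
have W1 : 0 < w t0 + 1 by rewrite ltr_wpDl.
have wnear : \forall t \near t0, w t <= w t0 + 1.
  have /cvgrPdist_lt /(_ 1 ltr01) := wc t0; apply: filterS => t /=.
  by have := ler_norm (w t - w t0); rewrite distrC; lra.
have cnear d : 0 < d -> \forall t \near t0, `|c t - c t0| < d.
  move=> d0; have /cvgrPdist_lt /(_ d d0) := cc t0.
  by apply: filterS => t /=; rewrite distrC.
have rho_small d rho t x : 0 < d -> rho <= d / 2 / (w t0 + 1) ->
    w t <= w t0 + 1 -> `|c t - c t0| < d / 2 -> 0 <= rho ->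
    `|x - c t| <= rho * w t -> `|x - c t0| < d.
  move=> d0; rewrite ler_pdivlMr// => rd wt ct rho0 xc.
  have : rho * w t <= rho * (w t0 + 1) by rewrite ler_wpM2l.
  by have := ler_distD (c t) x (c t0); lra.
have [ct0|ct0|ct0] := ltgtP (Phi (c t0)) a.
- pose kap := (a - Phi (c t0)) / 2.
  have kap0 : 0 < kap by rewrite divr_gt0// subr_gt0.
  have [d d0 dP] : exists2 d, 0 < d & forall x, `|x - c t0| < d ->
    Phi x <= a - kap.
    have /cvgrPdist_lt /(_ kap kap0) /nbhs_normP [d /= d0 dP] := cPhi (c t0).
    exists d => // x; rewrite distrC => /dP /=.
    have := ler_norm (Phi x - Phi (c t0)); rewrite distrC.
    have : kap = (a - Phi (c t0)) / 2 by [].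
    by lra.
  have d2 : 0 < d / 2 by rewrite divr_gt0.
  have [r r0 rP] := near_radius _ (filterI wnear (cnear _ d2)).
  exists r, (Num.min (kap / k) (d / 2 / (w t0 + 1))), 0.
  split=> //; [by rewrite lt_min (divr_gt0 kap0 k0) (divr_gt0 d2 W1)|by rewrite
    normr0|by left|].
  move=> t x sigma s t01 At /rP [wt ct] xc s10 s0;
    rewrite le_min => /andP[h _] _.
  rewrite scaler0 addr0.
  have h1 : Phi x <= a - kap.
    apply: dP; apply: rho_small xc => //; first by rewrite ge_min lexx orbT.
    by rewrite le_min (ltW (divr_gt0 kap0 k0)) (ltW (divr_gt0 d2 W1)).
  by move: h; rewrite ler_pdivlMr// mulrC; lra.
- exfalso.
  have e0 : 0 < Phi (c t0) - a by rewrite subr_gt0.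
  have cPc : {for t0, continuous (Phi \o c)}.
    by apply: continuous_comp; [exact: cc|exact: cPhi].
  have /cvgrPdist_lt /(_ _ e0) /near_radius [r r0 rP] := cPc.
  have [t [t01 At /rP /=]] := clA r r0.
  have := ler_norm (Phi (c t0) - Phi (c t)); have := ca t t01 At.
  lra.
- have [/andP[t00 t01] [v [b [v1 b0 /clarke_dderiv_ltP [d d0 dP] kb]]]] :=
    Hsteep clA ct0.
  have d2 : 0 < d / 2 by rewrite divr_gt0.
  have wnear2 : \forall t \near t0, k < b * w t.
    have h : k / b < w t0 by rewrite ltr_pdivrMr// mulrC.
    have : \forall t \near t0, k / b < w t
      by exact: (cvgr_gt (w t0) (wc t0) _ h).
    apply: filterS => t.
    by rewrite ltr_pdivrMr// mulrC.
  have [r r0 rP] := near_radius _ (filterI wnear (filterI wnear2 (cnear _ d2))).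
  (* The cell avoids both end points, and [rho] keeps [x] within [d] of [c t0] and the push shorter
     than [d], as the descent estimate requires. *)
  exists (Num.min r (Num.min t0 (1 - t0))), (d / 2 / (w t0 + 1)), v.
  split=> //.
  + by rewrite !lt_min r0 t00 subr_gt0.
  + by rewrite !divr_gt0.
  + right.
    have h1 : Num.min r (Num.min t0 (1 - t0)) <= t0
      by rewrite !ge_min lexx orbT.
    have h2 : Num.min r (Num.min t0 (1 - t0)) <= 1 - t0
      by rewrite !ge_min lexx !orbT.
    by rewrite h1; lra.
  + move=> t x sigma s t01' At; rewrite lt_min => /andP[/rP [wt [kwt ct]] _].
    move=> xc s10 s0 ssr Px.
    have rho0 : 0 <= d / 2 / (w t0 + 1) by rewrite !divr_ge0// ltW.
    have xd : `|x - c t0| < d by exact: rho_small xc.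
    move: s0; rewrite le_eqVlt => /predU1P[<-|s0].
      by rewrite mul0r scale0r !addr0.
    have wt0 : 0 < w t by rewrite -(pmulr_rgt0 _ b0) (lt_trans k0).
    have swd : s * w t < d.
      have h1 : s * w t <= d / 2 / (w t0 + 1) * (w t0 + 1).
        by apply: ler_pM => //; [exact: ltW|lra].
      by move: h1; rewrite divfK ?gt_eqF//; lra.
    have := dP x (s * w t) xd (mulr_gt0 s0 wt0) swd.
    have : s * k < s * (b * w t) by rewrite ltr_pM2l.
    rewrite mulrN mulrDr (mulrC s k) -mulrA (mulrC (w t) b).
    lra.
Qed.

(** States are pairs of an elapsed time and a curve obeying the bounds up to that time. These
    conditions are closed, so increasing sequences have limits among the states; a maximal state
    with time left could be pushed further. *)
Lemma descent_deformation c0 (w : R -> R) A (a k T : R) :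
  continuous Phi -> continuous c0 -> continuous w -> (forall t, 0 <= w t) ->
  0 < k -> 0 <= T ->
  (forall t, t \in `[0, 1] -> A t -> Phi (c0 t) <= a) ->
  (forall c tau t0, 0 <= tau < T -> (forall t, `|c t - c0 t| <= tau * w t) ->
     c 0 = c0 0 -> c 1 = c0 1 -> t0 \in `[0, 1] -> unit_cluster A t0 ->
     Phi (c t0) = a - k * tau -> steep w k c t0) ->
  exists c, [/\ continuous c, c 0 = c0 0, c 1 = c0 1,
    forall t, `|c t - c0 t| <= T * w t &
    forall t, t \in `[0, 1] -> A t -> Phi (c t) <= a - k * T].
Proof.
move=> cPhi cc0 wc w0 k0 T0 ca Hsteep.
pose D (q : R * (R -> X)) := [/\ 0 <= q.1 <= T, continuous q.2,
  q.2 0 = c0 0 /\ q.2 1 = c0 1, forall t, `|q.2 t - c0 t| <= q.1 * w t &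
  forall t, t \in `[0, 1] -> A t -> Phi (q.2 t) <= a - k * q.1].
pose le (q q' : R * (R -> X)) := q.1 <= q'.1 /\
  forall t, `|q'.2 t - q.2 t| <= (q'.1 - q.1) * w t.
have le_refl q : le q q.
  by split=> // t; rewrite !subrr normr0 mul0r.
have le_trans_ q q' q'' : le q q' -> le q' q'' -> le q q''.
  move=> [h1 h2] [h3 h4]; split; first exact: le_trans h3.
  move=> t; have := ler_distD (q'.2 t) (q''.2 t) (q.2 t).
  have := h2 t; have := h4 t; rewrite !mulrBl; lra.
have D0 : D (0, c0).
  split=> //= [|t|t t01 At]; first by rewrite lexx.
    by rewrite subrr normr0 mul0r.
  by rewrite mulr0 subr0 ca.
have [|||[tau c] [[/= /andP[tau0 tauT] cc [c00 c01] cw cA] _ qmax]] :=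
  @exists_maximal_above R _ D le fst T _ le_refl le_trans_ _ _ _ D0.
- by move=> q q' [].
- by move=> q [/andP[]].
- move=> s Ds les.
  have le_mono n m : (n <= m)%N -> le (s n) (s m).
    move=> /subnK <-; elim: (m - n)%N => //= i IH.
    exact: le_trans_ IH (les _).
  have [n|n|n m nm|n m nm t|d [l [cd s2d s1l sl ds]]] :=
    @weighted_uniform_limit R X (fun n => (s n).2) (fun n => (s n).1) w T _ wc
      w0.
  + by have [] := Ds n.
  + by have [/andP[]] := Ds n.
  + by have [] := le_mono _ _ nm.
  + by have [_] := le_mono _ _ nm.
  exists (l, d); last by move=> n; split.
  split=> //=.
  + apply/andP; split.
      by have [/andP[h _] _ _ _ _] := Ds 0%N; exact: le_trans h (sl 0%N).
    apply: (closed_cvg (fun x => x <= T)) s1l; first exact: closed_le.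
    by apply: nearW => n; have [/andP[]] := Ds n.
  + have limE t : (forall n, (s n).2 t = c0 t) -> d t = c0 t.
      move=> st; have := s2d t; under eq_fun do rewrite st.
      move=> h; apply: (cvg_unique _ h); [exact: norm_hausdorff|exact: cvg_cst].
    by split; apply: limE => n; have [_ _ []] := Ds n.
  + move=> t; have [_ _ _ h _] := Ds 0%N.
    have := ler_distD ((s 0%N).2 t) (d t) (c0 t); have := h t; have := ds 0%N t.
    by rewrite !mulrBl; lra.
  + move=> t t01 At.
    have : Phi ((s n).2 t) + k * (s n).1 @[n --> \oo] --> Phi (d t) + k * l.
      apply: cvgD; last by apply: cvgMl_tmp; exact: s1l.
      by apply: (cvg_comp (fun n => (s n).2 t) Phi); [exact: s2d|exact: cPhi].
    move=> h; suff : Phi (d t) + k * l <= a by lra.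
    apply: (closed_cvg (fun x => x <= a)) h; first exact: closed_le.
    by apply: nearW => n; have [_ _ _ _ h] := Ds n; have := h t t01 At; lra.
have [tauE|tauNE] := eqVneq tau T.
  by exists c; split=> //; rewrite -tauE.
have tau_lt : tau < T by rewrite lt_neqAle tauNE.
have hT : 0 < T - tau by rewrite subr_gt0.
(* Capping the push by the remaining time keeps the new pair a state, with larger time than the
   maximal one. *)
have [|h [c' [/andP[h0 hT'] cc' [c'0 c'1] c'c c'A]]] :=
  @push_curve R X Phi c w A (a - k * tau) k (T - tau) cc wc w0 hT cA.
  move=> t0 t01; apply: exists_descent_cell => // clA ct0.
  by apply: (Hsteep c tau) => //; rewrite tau0.
have := qmax (tau + h, c') => /=.
have h1 : D (tau + h, c').
  split=> /= [|//||t|t t01 At].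
  - by apply/andP; split; lra.
  - by rewrite c'0 c'1.
  - have := ler_distD (c t) (c' t) (c0 t); have := c'c t; have := cw t.
    by rewrite mulrDl; lra.
  - by have := c'A t t01 At; rewrite mulrDr; lra.
have h2 : le (tau, c) (tau + h, c').
  split=> /=; first by lra.
  by move=> t; rewrite addrAC subrr add0r; exact: c'c.
by move=> /(_ h1 h2); lra.
Qed.

End Deformation.

(** * The minimax value *)

Section Paths.
Variables (R : realType) (X : normedModType R) (Phi : X -> R) (z0 z1 : X).

(** Composition with the retraction of the line onto the unit interval gives the global continuity
    that the deformation uses. *)
Lemma paths_extend (c : R -> X) : paths z0 z1 c ->
  exists d : R -> X, [/\ continuous d, d 0 = z0, d 1 = z1 &
    forall t, t \in `[0, 1] -> d t = c t].
Proof.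
move=> [/subspace_continuousP cc c0 c1].
pose p (t : R) := Num.max 0 (Num.min 1 t).
have pE t : t \in `[0, 1] -> p t = t.
  by rewrite in_itv/= => /andP[t0 t1]; rewrite /p min_r// max_r.
have p01 t : p t \in `[0, 1].
  by rewrite in_itv/= le_max lexx /= ge_max ler01 ge_min lexx.
have pc : continuous p.
  apply: (@continuous_maxr _ (fun=> 0)); first by move=> ?; exact: cvg_cst.
  apply: (@continuous_minr _ (fun=> 1)); first by move=> ?; exact: cvg_cst.
  by move=> t; exact: cvg_id.
exists (c \o p); split.
- move=> t; apply/cvgrPdist_lt => e e0.
  have /cvgrPdist_lt /(_ e e0) := cc (p t) (p01 t).
  rewrite near_withinE => /nbhs_normP [d /= d0 dP].
  have /cvgrPdist_lt /(_ d d0) := pc t; apply: filterS => s /= ps.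
  by apply: dP => //; exact: p01.
- by rewrite /= pE// in_itv/= lexx ler01.
- by rewrite /= pE// in_itv/= lexx ler01.
- by move=> t t01 /=; rewrite pE.
Qed.

(** The segment provides a competitor and [Phi z0] a lower bound, so the [inf] is genuine rather
    than a default value. *)
Lemma minimax_value_adherent (eta : R) : continuous Phi -> 0 < eta ->
  exists c : R -> X, [/\ continuous c, c 0 = z0, c 1 = z1 &
    forall t, t \in `[0, 1] -> Phi (c t) <= minimax_value Phi z0 z1 + eta].
Proof.
move=> cPhi eta0.
have hinf : has_inf [set M : R | exists2 c : R -> X, paths z0 z1 c &
    is_max [set Phi (c t) | t in `[0, 1]] M].
  split.
  - have cseg : {within `[0, 1], continuous (Phi \o segment _ _ z0 z1)}.
      apply: continuous_subspaceT => t.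
      by apply: continuous_comp; [exact: continuous_segment|exact: cPhi].
    have [t t01 tmax] := EVT_max ler01 cseg.
    exists (Phi (segment _ _ z0 z1 t)), (segment _ _ z0 z1).
      split; last 2 first.
      + by rewrite /segment scale0r addr0.
      + by rewrite /segment scale1r addrC subrK.
      by apply: continuous_subspaceT => s; exact: continuous_segment.
    by split; [exists t|move=> _ [s s01 <-]; exact: tmax].
  - exists (Phi z0) => M [c [_ c0 _] [_ Mub]]; apply: Mub.
    by exists 0; rewrite /= ?c0// in_itv/= lexx ler01.
have [M [c cpath [_ Mub]] Mlt] := inf_adherent eta0 hinf.
have [d [dc d0 d1 dE]] := paths_extend _ cpath.
exists d; split=> // t t01; apply: le_trans (ltW Mlt).
by rewrite dE//; apply: Mub; exists t.
Qed.

(** Otherwise the parameters sent to [U0] would form a nonempty proper subset, open and closed in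
    the connected unit interval. *)
Lemma separates_path (S : set X) (c : R -> X) : separates S z0 z1 ->
  continuous c -> c 0 = z0 -> c 1 = z1 ->
  exists2 t, t \in `[0, 1] & S (c t).
Proof.
move=> [U0 [U1 [oU0 oU1 SC U01 [U0z0 U1z1]]]] cc c0 c1.
apply: contrapT => nS.
have cO t : t \in `[0, 1] -> U0 (c t) \/ U1 (c t).
  move=> t01; suff : (~` S) (c t) by rewrite SC.
  by move=> St; apply: nS; exists t.
have nO x : U0 x -> U1 x -> False.
  by move=> x0 x1; have : (U0 `&` U1) x by []; rewrite U01.
have t00 : 0 \in `[0, 1 : R] by rewrite in_itv/= lexx ler01.
have t11 : 1 \in `[0, 1 : R] by rewrite in_itv/= lexx ler01.
pose I : set R := `[0, 1]%classic.
have : I `&` c @^-1` U0 = I.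
  apply: (@segment_connected R 0 1).
  - by exists 0; split=> //=; rewrite c0.
  - exists (c @^-1` U0) => //.
    by apply: open_comp => // t _; exact: cc.
  - exists (~` (c @^-1` U1)).
      by apply: open_closedC; apply: open_comp => // t _; exact: cc.
    apply/seteqP; split=> t [t01 /= ct]; split=> //.
      by move=> /(nO _ ct).
    by have [//|] := cO t t01.
move=> E; apply: (nO z1) => //.
have : I 1 by [].
by rewrite -E => -[_ /=]; rewrite c1.
Qed.

End Paths.

(** * Almost critical points near [F] *)

Section MinMax.
Variables (R : realType) (X : completeNormedModType R) (Phi : X -> R).
Variables (z0 z1 : X) (F : set X).
Let gamma := minimax_value Phi z0 z1.

(** Keeps the parameters that must move away from 0 and 1: an end point is either at positive
    distance from [F], or in [F] with value strictly below [gamma]. *)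
Lemma endpoint_radius (z : X) (q : R) : closed F -> 0 < q ->
  ~ (F `&` superlevel Phi gamma) z -> exists2 T0 : R, 0 < T0 &
  forall T, 0 < T -> T <= T0 ->
    (forall y, F y -> 2 * T * (1 + `|z|) < `|z - y|) \/ Phi z < gamma - q * T.
Proof.
move=> cF q0 nS; have zz : 0 < 1 + `|z| by rewrite ltr_wpDr.
have [Fz|nFz] := pselect (F z).
- have Pz : Phi z < gamma.
    by rewrite ltNge; apply/negP => h; apply: nS.
  have h : 0 < gamma - Phi z by rewrite subr_gt0.
  exists ((gamma - Phi z) / q / 2); first by rewrite !divr_gt0.
  move=> T T0; rewrite -mulrA -invfM ler_pdivlMr ?mulr_gt0// => h1; right.
  by move: h1; rewrite mulrA (mulrC T); lra.
- have /nbhs_normP [d /= d0 dP] : nbhs z (~` F).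
    by apply: open_nbhs_nbhs; split=> //; exact: closed_openC.
  exists (d / (3 * (1 + `|z|))); first by rewrite !divr_gt0// mulr_gt0.
  move=> T T0; rewrite ler_pdivlMr ?mulr_gt0// => h; left=> y Fy.
  rewrite ltNge; apply/negP => h1; apply: (dP y) => //=.
  have := mulr_gt0 T0 zz; lra.
Qed.

Lemma exists_almost_critical (e : R) : locally_lipschitz Phi -> closed F ->
  separates (F `&` superlevel Phi gamma) z0 z1 -> 0 < e -> e <= 1 ->
  exists x y, [/\ F y, `|x - y| <= e * (1 + `|x|), `|Phi x - gamma| <= e &
    forall v, `|v| <= 1 ->
      ((- (e / (1 + `|x|)))%:E <= clarke_dderiv Phi x v)%E].
Proof.
move=> lip cF sep e0 e1; have cPhi := locally_lipschitz_continuous _ _ _ lip.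
apply: contrapT => nH.
have H x y : F y -> `|x - y| <= e * (1 + `|x|) -> `|Phi x - gamma| <= e ->
    exists2 v, `|v| <= 1 & (clarke_dderiv Phi x v < (- (e / (1 + `|x|)))%:E)%E.
  move=> Fy xy xg; apply: contrapT => h; apply: nH; exists x, y;
    split=> // v v1.
  by rewrite leNgt; apply/negP => h'; apply: h; exists v.
have [nS0 nS1] : ~ (F `&` superlevel Phi gamma) z0 /\ ~ (F `&` superlevel Phi
  gamma) z1.
  have [U0 [U1 [_ _ SC _ [h0 h1]]]] := sep.
  split=> h.
    by have : (~` (F `&` superlevel Phi gamma)) z0 by rewrite SC; left.
  by have : (~` (F `&` superlevel Phi gamma)) z1 by rewrite SC; right.
have q0 : 0 < e / 8 by rewrite divr_gt0.
have [T0 T00 HT0] := endpoint_radius _ _ cF q0 nS0.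
have [T1 T10 HT1] := endpoint_radius _ _ cF q0 nS1.
(* A clustering parameter starts within [2 T w] of [F] and moves by at most [T w]. As
   [w <= 2 (1 + |c|)], its distance to [F] is at most [6 T (1 + |c|)], whence [e / 6]. *)
pose T := Num.min (e / 6) (Num.min T0 T1).
have T_gt0 : 0 < T by rewrite !lt_min T00 T10 divr_gt0.
have Te : T <= e / 6 by rewrite ge_min lexx.
have {}HT0 := HT0 T T_gt0 ltac:(by rewrite !ge_min lexx orbT).
have {}HT1 := HT1 T T_gt0 ltac:(by rewrite !ge_min lexx !orbT).
(* The available rate [e w / (1 + |c|)] is at least [e / 2], strictly above [k]. *)
pose k := e / 4.
have k0 : 0 < k by rewrite divr_gt0.
have kE : k = e / 4 by [].
(* With [k T = 2 eta], the level falls from [gamma + eta] to [gamma - eta]. *)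
pose eta := e / 8 * T.
have eta0 : 0 < eta by rewrite mulr_gt0.
have kT : k * T = 2 * eta by rewrite /k /eta; lra.
have etae : eta <= e.
  have : e / 8 * T <= e / 8 * 1 by rewrite ler_pM2l//; lra.
  by rewrite /eta; lra.
have [c0 [cc0 c00 c01 c0le]] :=
  minimax_value_adherent _ _ _ z0 z1 eta cPhi eta0.
pose w t := 1 + `|c0 t|.
have wE t : w t = 1 + `|c0 t| by [].
have w_gt0 t : 0 < w t by rewrite ltr_wpDr.
have wc : continuous w.
  move=> t; apply: cvgD; first exact: cvg_cst.
  by apply: cvg_norm; exact: cc0.
pose A := [set t : R | exists2 y, F y & `|c0 t - y| <= T * w t].
have clusterA t0 : unit_cluster _ A t0 ->
    exists2 y, F y & `|c0 t0 - y| <= 2 * T * w t0.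
  move=> clA; have Tw : 0 < T * w t0 / 2 by rewrite divr_gt0// mulr_gt0.
  have /cvgrPdist_lt /(_ _ Tw) /nbhs_normP [r /= r0 rP] := cc0 t0.
  have [t [_ [y Fy ty] tr]] := clA r r0; exists y => //.
  have h1 := rP t; rewrite /ball_/= distrC in h1; have {}h1 := h1 tr.
  have h2 : w t <= w t0 + T * w t0 / 2.
    have := ler_normB (c0 t0) (c0 t0 - c0 t); rewrite subKr.
    by have := wE t; have := wE t0; lra.
  have h3 : T * w t <= T * (w t0 + T * w t0 / 2) by rewrite ler_pM2l.
  have h4 : T * (T * w t0) <= 1 * (T * w t0).
    by rewrite ler_pM2r ?mulr_gt0//; lra.
  have := ler_distD (c0 t) (c0 t0) y.
  lra.
have [||c [cc c_0 c_1 cw cA]] :=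
  @descent_deformation R X Phi c0 w A (gamma + eta) k T
  cPhi cc0 wc (fun t => ltW (w_gt0 t)) k0 (ltW T_gt0).
- by move=> t t01 _; exact: c0le.
- move=> c tau t0 /andP[tau0 tauT] cw c_0 c_1 t01 /clusterA [y Fy ty] ct0.
  have ktau : k * tau < k * T by rewrite ltr_pM2l.
  have ktau0 : 0 <= k * tau by rewrite mulr_ge0// ltW.
  have Phigt : gamma - eta < Phi (c t0) by rewrite ct0; lra.
  split.
    have t00 : t0 != 0.
      apply/eqP => t00; case: HT0 => [/(_ y Fy)|]; move: ty Phigt; rewrite t00.
        by rewrite /w c00; lra.
      by rewrite c_0 c00 /eta; lra.
    have t01' : t0 != 1.
      apply/eqP => t01'; case: HT1 => [/(_ y Fy)|]; move: ty Phigt;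
        rewrite t01'.
        by rewrite /w c01; lra.
      by rewrite c_1 c01 /eta; lra.
    by move: t01; rewrite in_itv/= !lt_neqAle eq_sym t00 t01'.
  have nc : 0 < 1 + `|c t0| by rewrite ltr_wpDr.
  have tauw : tau * w t0 <= T * w t0 by rewrite ler_pM2r// ltW.
  have Tw : T * w t0 <= 2^-1 * w t0 by rewrite ler_pM2r//; lra.
  have cct := cw t0.
  (* The displacement is at most half of [w], so [w] and [1 + |c|] agree up to a factor 2. *)
  have wle : w t0 <= 2 * (1 + `|c t0|).
    have := ler_normB (c t0) (c t0 - c0 t0); rewrite subKr.
    by have := wE t0; lra.
  have cle : 1 + `|c t0| <= 2 * w t0.
    have := ler_normD (c0 t0) (c t0 - c0 t0); rewrite addrC subrK.
    by have := wE t0; have := w_gt0 t0; lra.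
  have [||v v1 Dv] := H (c t0) y Fy.
  + have h1 : T * w t0 <= T * (2 * (1 + `|c t0|)) by rewrite ler_pM2l.
    have h2 : T * (1 + `|c t0|) <= e / 6 * (1 + `|c t0|) by rewrite ler_pM2r.
    have := ler_distD (c0 t0) (c t0) y.
    by move: h1; rewrite mulrCA; lra.
  + by rewrite ct0; apply/ler_normlP; split; lra.
  exists v, (e / (1 + `|c t0|)); split=> //; first by rewrite divr_gt0.
  rewrite mulrAC ltr_pdivlMr//.
  have : k * (1 + `|c t0|) <= k * (2 * w t0) by rewrite ler_pM2l.
  have := mulr_gt0 e0 (w_gt0 t0).
  by rewrite kE; lra.
have [t t01 [Ft ct]] := separates_path _ _ _ _ _ _ sep cc
  (etrans c_0 c00) (etrans c_1 c01).
have At : A t by exists (c t) => //; rewrite distrC.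
have := cA t t01 At; move: ct; rewrite /superlevel /=.
lra.
Qed.

End MinMax.

(** * Passage to the limit *)

Theorem theorem1p11 (R : realType) (X : completeNormedModType R)
    (Phi : X -> R) (z0 z1 : X) (F : set X)
    (hPhi : locally_lipschitz Phi)
    (hF : closed F)
    (hsep : separates (F `&` superlevel Phi (minimax_value Phi z0 z1)) z0 z1)
    (hCPS : CPS Phi F (minimax_value Phi z0 z1)) :
  exists x : X,
    Phi x = minimax_value Phi z0 z1 /\ clarke_gradient Phi x \0.
Proof.
set gamma := minimax_value Phi z0 z1 in hsep hCPS *.
(* Halving gives [e n <= 1/2], as the bound on the geodesic distance requires. *)
pose e (n : nat) : R := harmonic n / 2.
have e0 n : 0 < e n by rewrite divr_gt0// invr_gt0.
have e2 n : e n <= 2^-1.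
  by rewrite /e ler_piMl// /harmonic/= invf_le1// ler1n.
have ecvg : e @ \oo --> (0 : R).
  by rewrite -(mul0r 2^-1); apply: cvgMr_tmp; exact: cvg_harmonic.
have /choice [x xP] : forall n, exists x, exists y,
    [/\ F y, `|x - y| <= e n * (1 + `|x|), `|Phi x - gamma| <= e n &
    forall v, `|v| <= 1 ->
      ((- (e n / (1 + `|x|)))%:E <= clarke_dderiv Phi x v)%E].
  move=> n; apply: exists_almost_critical => //.
  by apply: le_trans (e2 n) _; rewrite invf_le1// ler1n.
have /choice [m mP] := fun n => clarke_gradient_min_norm _ _ _ hPhi (x n).
have x1 n : 0 < 1 + `|x n| by rewrite ltr_wpDr.
have Phix : Phi (x n) @[n --> \oo] --> gamma.
  apply/cvgrPdist_le => d d0; have /cvgrPdist_le /(_ d d0) := ecvg.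
  apply: filterS => n; rewrite sub0r normrN gtr0_norm// => ed.
  by have [y [_ _ h _]] := xP n; rewrite distrC (le_trans h).
have mle n : (1 + `|x n|) * m n <= e n.
  have [y [_ _ _ xd]] := xP n.
  have [_ _ _ mmin] := mP n.
  rewrite mulrC -ler_pdivlMr//; apply: mmin => //.
  by rewrite divr_ge0// ltW.
have mm n : m n <= e n.
  have [m0 _ _ _] := mP n; apply: le_trans (mle n).
  by rewrite ler_peMl// lerDl.
have [k [kinc kcvg]] : exists k : nat -> nat,
    increasing_seq k /\ cvg (x (k n) @[n --> \oo]).
  apply: (hCPS x m) => //.
  - apply: (@squeeze_cvge _ _ _ _ (fun=> 0%E) _ (fun n => (2 * e n)%:E)).
    + apply: nearW => n; rewrite geodesic_setdist_ge0 /=.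
      by have [y [Fy xy _ _]] := xP n; exact: geodesic_setdist_le Fy (e2 n) xy.
    + exact: cvg_cst.
    + apply: cvg_EFin; first exact: nearW.
      by rewrite -(mulr0 2); apply: cvgMl_tmp.
  - by move=> n; have [_ h _ _] := mP n.
  - apply: (@squeeze_cvgr _ _ _ _ (fun=> 0) e) => //; last exact: cvg_cst.
    apply: nearW => n; rewrite mle andbT; have [m0 _ _ _] := mP n.
    by rewrite mulr_ge0// ltW.
have /increasing_seqP kS := kinc.
have kge n : (n <= k n)%N by elim: n => // n IH; exact: leq_ltn_trans IH (kS n).
have koo : k @ \oo --> \oo.
  move=> B [N _ NB]; exists N => // n /= Nn; apply: NB => /=.
  exact: leq_trans (kge n).
set xb := lim (x (k n) @[n --> \oo]) in kcvg.
have {}kcvg : x (k n) @[n --> \oo] --> xb by [].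
exists xb; split.
  apply: (@cvg_unique _ _ (Phi (x (k n)) @[n --> \oo]));
    first exact: norm_hausdorff.
    apply: (cvg_comp (fun n => x (k n)) Phi kcvg).
    exact: locally_lipschitz_continuous.
  exact: (cvg_comp k (fun n => Phi (x n)) koo Phix).
split; first by move=> y; exact: cvg_cst.
move=> v; rewrite leNgt; apply/negP => Dv.
(* Semicontinuity carries the negative bound [a] to the points [x (k n)], where the derivative along
   [v] is at least [- e (k n) |v|]; this is impossible once [e (k n)] is small. *)
have [a a0 Da] : exists2 a, a < 0 & (clarke_dderiv Phi xb v < a%:E)%E.
  have {}Dv : (clarke_dderiv Phi xb v < 0%:E)%E by exact: Dv.
  move: Dv; rewrite -clarke_dderivE// lte_fin => Dv.
  by exists (fine (clarke_dderiv Phi xb v) / 2); rewrite ?lte_fin; lra.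
have near1 : \forall n \near \oo, (clarke_dderiv Phi (x (k n)) v <= a%:E)%E :=
  kcvg _ (clarke_dderiv_near_le _ _ _ _ _ _ Da).
have v1 : 0 < `|v| + 1 by rewrite ltr_wpDl.
have av : 0 < - a / (`|v| + 1) by rewrite divr_gt0// oppr_gt0.
have ek : e (k n) @[n --> \oo] --> (0 : R) by exact: (cvg_comp k e koo ecvg).
have near2 : \forall n \near \oo, e (k n) < - a / (`|v| + 1).
  exact: (cvgr_lt _ ek).
have [n [/= h1]] := filter_ex (filterI near1 near2).
rewrite ltr_pdivlMr// => h2.
have [_ _ /(_ v) h3 _] := mP (k n).
have := le_trans h3 h1; rewrite lee_fin => h4.
have h5 : m (k n) * `|v| <= e (k n) * `|v| by rewrite ler_wpM2r.
have := e0 (k n); lra.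
Qed.
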